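(* Let $f:\mathbb{R}^n\to\mathbb{R}\cup\{+\infty\}$ and $g:\mathbb{R}^m\to\mathbb{R}\cup\{+\infty\}$ be proper lower semicontinuous convex functions, $A\in\mathbb{R}^{m\times n}$, and $\eta>0$. Consider the primal-dual problem $\min_x\max_\lambda L(x,\lambda)=f(x)-\lambda^TAx-g^*(\lambda)$, and let $z^k=(x^k,\lambda^k)$, $k\ge0$, be generated by the primal-dual hybrid gradient method (PDHG) $$x^{k+1}=\arg\min_x\Big\{f(x)-\langle A^T\lambda^k,x-x^k\rangle+\tfrac1{2\eta}\|x-x^k\|_2^2\Big\},$$ $$\lambda^{k+1}=\arg\min_\lambda\Big\{g^*(\lambda)+\langle A(2x^{k+1}-x^k),\lambda-\lambda^k\rangle+\tfrac1{2\eta}\|\lambda-\lambda^k\|_2^2\Big\}.$$ Then for all $k\ge0$, $$P(z^k-z^{k+1})\in\mathcal{F}(z^{k+1}),\qquad P=\begin{pmatrix}\frac1\eta I & A^T \\ A & \frac1\eta I\end{pmatrix}.$$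
   Context: $g^*(\lambda)=\max_y\{\lambda^Ty-g(y)\}$ (i.e. supremum) is the convex conjugate of $g$. For $z=(x,\lambda)$, $\mathcal{F}(z)=\begin{pmatrix}\partial_xL(x,\lambda) \\ -\partial_\lambda L(x,\lambda)\end{pmatrix}=\begin{pmatrix}\partial f(x)-A^T\lambda \\ \partial g^*(\lambda)+Ax\end{pmatrix}$, with $\partial$ the convex subdifferential. *)

(* Defs.v *)
From HB Require Import structures.
From mathcomp Require Import all_boot all_order all_algebra.
From mathcomp Require Import all_classical all_reals.
From mathcomp Require Import ereal topology normedtype.
From mathcomp Require Import ring.

Set Implicit Arguments.
Unset Strict Implicit.
Unset Printing Implicit Defensive.

Import Order.TTheory GRing.Theory Num.Theory.
Import numFieldNormedType.Exports.

Local Open Scope classical_set_scope.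
Local Open Scope ring_scope.

Section convex_analysis.
Variables (R : realType) (n : nat).
Implicit Types (u v x y : 'cV[R]_n) (f : 'cV[R]_n -> \bar R).

Definition dot u v : R := (u^T *m v) 0 0.

(* The squared Euclidean norm; the library norm `|u| on matrices is the sup
   norm. *)
Definition sqnorm2 u : R := dot u u.

(* The codomain \bar R also contains -oo, so the condition that f takes values
   in R U {+oo} is part of properness. *)
Definition proper_fun f : Prop :=
  (forall x, f x != -oo%E) /\ (exists x, f x != +oo%E).

(* Only used together with [proper_fun], so that +oo - oo never occurs on the
   right-hand side; at t = 0, 1 the convention 0 * +oo = 0 makes it trivial. *)
Definition convex_fun f : Prop :=
  forall x y (t : R), 0 <= t <= 1 ->
    (f (t *: x + (1 - t) *: y)%R <= t%:E * f x + (1 - t)%:E * f y)%E.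

Definition conjugate f (l : 'cV[R]_n) : \bar R :=
  ereal_sup [set ((dot l y)%:E - f y)%E | y in [set: 'cV[R]_n]].

(* Empty outside the points where f is finite, as usual. *)
Definition subdiff f x : set 'cV[R]_n :=
  [set v | f x \is a fin_num /\
           forall y, (f x + (dot v (y - x)%R)%:E <= f y)%E].

Definition argmin f : set 'cV[R]_n := [set x | forall y, (f x <= f y)%E].

End convex_analysis.

Section pdhg.
Variables (R : realType) (n m : nat).
Variables (f : 'cV[R]_n -> \bar R) (g : 'cV[R]_m -> \bar R).
Variable A : 'M[R]_(m, n).
Implicit Types (x : 'cV[R]_n) (l : 'cV[R]_m).

(* When f x and g^* l are both +oo this is the meaningless +oo - oo; such pairs
   do not contribute to [saddle_op], see [saddle_opE]. *)
Definition lagrangian x l : \bar R :=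
  (f x - (dot l (A *m x))%:E - conjugate g l)%E.

(* A point z = (x, l) is the stacked column vector [col_mx x l].  As L is
   concave in l, the block - \partial_l L is the subdifferential of - L. *)
Definition saddle_op (z : 'cV[R]_(n + m)) : set 'cV[R]_(n + m) :=
  let x := usubmx z in let l := dsubmx z in
  [set col_mx u v | u in subdiff (fun x' => lagrangian x' l) x
                  & v in subdiff (fun l' => - lagrangian x l')%E l].

Definition pdhg_mx (eta : R) : 'M[R]_(n + m) :=
  block_mx (eta^-1)%:M A^T A (eta^-1)%:M.

Definition primal_objective (eta : R) (xk : 'cV[R]_n) (lk : 'cV[R]_m) x :
    \bar R :=
  (f x + (- dot (A^T *m lk) (x - xk)
          + (2 * eta)^-1 * sqnorm2 (x - xk))%R%:E)%E.

Definition dual_objective (eta : R) (xk xk1 : 'cV[R]_n) (lk : 'cV[R]_m) l :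
    \bar R :=
  (conjugate g l + (dot (A *m (2 *: xk1 - xk)) (l - lk)
                    + (2 * eta)^-1 * sqnorm2 (l - lk))%R%:E)%E.

Definition pdhg (eta : R) (x : nat -> 'cV[R]_n) (l : nat -> 'cV[R]_m) : Prop :=
  forall k,
    argmin (primal_objective eta (x k) (l k)) (x k.+1) /\
    argmin (dual_objective eta (x k) (x k.+1) (l k)) (l k.+1).

Lemma dotDl p (u v w : 'cV[R]_p) : dot (u + v) w = dot u w + dot v w.
Proof. by rewrite /dot linearD mulmxDl mxE. Qed.

Lemma dotNl p (u w : 'cV[R]_p) : dot (- u) w = - dot u w.
Proof. by rewrite /dot linearN mulNmx mxE. Qed.

Lemma dotC p (u v : 'cV[R]_p) : dot u v = dot v u.
Proof. by rewrite /dot -{1}[v]trmxK -trmx_mul mxE. Qed.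

Lemma dotBr p (u v w : 'cV[R]_p) : dot u (v - w) = dot u v - dot u w.
Proof. by rewrite dotC dotDl dotNl !(dotC _ u). Qed.

Lemma dot_trmx x l : dot (A^T *m l) x = dot l (A *m x).
Proof. by rewrite /dot trmx_mul trmxK mulmxA. Qed.

Lemma conjugate_Ny l : proper_fun g -> conjugate g l != -oo%E.
Proof.
move=> [gNy [y gy]]; rewrite -ltNye.
apply: (@lt_le_trans _ _ ((dot l y)%:E - g y)%E); last first.
  by apply: ereal_sup_ubound; exists y.
by move: (gNy y) gy; case: (g y) => // r _ _; rewrite ltNyr.
Qed.

(* The operator in explicit form, (\partial f(x) - A^T l, \partial g^*(l) + A x),
   for all z, including those where f x or g^* l is +oo (both sides are then
   empty). *)
Lemma saddle_opE x l : proper_fun f -> proper_fun g ->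
  saddle_op (col_mx x l) =
  [set col_mx (u - A^T *m l) (v + A *m x)
     | u in subdiff f x & v in subdiff (conjugate g) l].
Proof.
move=> [fNy _] pg; have cNy l' := conjugate_Ny l' pg.
rewrite /saddle_op col_mxKu col_mxKd /subdiff /lagrangian.
have E1 u (cl : conjugate g l \is a fin_num) (fx : f x \is a fin_num) y :
    (f x - (dot l (A *m x))%:E - conjugate g l + (dot u (y - x))%:E
       <= f y - (dot l (A *m y))%:E - conjugate g l)%E
    = (f x + (dot (u + A^T *m l) (y - x))%:E <= f y)%E.
  move: cl fx (fNy y); case: (conjugate g l) => // c _; case: (f x) => // a _.
  case: (f y) => [b||] // _; rewrite ?leey //.
  rewrite -?EFinN -?EFinD ?lee_fin dotDl dot_trmx mulmxBr !dotBr.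
  by rewrite -[LHS]subr_ge0 -[RHS]subr_ge0; congr (_ <= _); ring.
have E2 v (cl : conjugate g l \is a fin_num) (fx : f x \is a fin_num) y :
    (- (f x - (dot l (A *m x))%:E - conjugate g l) + (dot v (y - l))%:E
       <= - (f x - (dot y (A *m x))%:E - conjugate g y))%E
    = (conjugate g l + (dot (v - A *m x) (y - l))%:E <= conjugate g y)%E.
  move: cl fx (cNy y); case: (conjugate g l) => // c _; case: (f x) => // a _.
  case: (conjugate g y) => [b||] // _; rewrite ?leey //.
  rewrite -?EFinN -?EFinD -?EFinN -?EFinD ?lee_fin dotDl dotNl.
  rewrite !(dotBr _ y l) !(dotC (A *m x)).
  by rewrite -[LHS]subr_ge0 -[RHS]subr_ge0; congr (_ <= _); ring.
have F : (f x - (dot l (A *m x))%:E - conjugate g l \is a fin_num)%E ->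
    f x \is a fin_num /\ conjugate g l \is a fin_num.
  by case: (f x) => [a||]; case: (conjugate g l) => [b||].
have FL : f x \is a fin_num -> conjugate g l \is a fin_num ->
    (f x - (dot l (A *m x))%:E - conjugate g l \is a fin_num)%E.
  by case: (f x) => [a||] //; case: (conjugate g l) => [b||].
apply/seteqP; split => w /= [u [Lf Hu] [v [Lf' Hv] <-]].
  have [fx cl] := F Lf.
  exists (u + A^T *m l); first by split => // y; rewrite -E1.
  exists (v - A *m x); first by split => // y; rewrite -E2.
  by rewrite addrK subrK.
exists (u - A^T *m l).
  by split => [|y]; [exact: FL|rewrite E1 // subrK].
exists (v + A *m x) => //.
by split => [|y]; [rewrite fin_numN; exact: FL|rewrite E2 // addrK].
Qed.

End pdhg.

(* Main.v *)
Require Import Defs.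
From HB Require Import structures.
From mathcomp Require Import all_boot all_order all_algebra.
From mathcomp Require Import all_classical all_reals.
From mathcomp Require Import ereal topology normedtype.
From mathcomp Require Import ring lra.

Set Implicit Arguments.
Unset Strict Implicit.
Unset Printing Implicit Defensive.

Import Order.TTheory GRing.Theory Num.Theory.
Import numFieldNormedType.Exports.

(** Each PDHG update minimizes a convex function plus a quadratic
    [dot w (y - a) + c * sqnorm2 (y - a)], so Fermat's rule says that minus the
    gradient of the quadratic at the minimizer is a subgradient of the convex
    function there ([subdiff_argmin]).  The two updates thus give
      eta^-1 (x_k - x_{k+1}) + A^T l_k            in  \partial f (x_{k+1}),
      eta^-1 (l_k - l_{k+1}) - A (2 x_{k+1} - x_k) in  \partial g^* (l_{k+1}),
    and subtracting A^T l_{k+1} from the first and adding A x_{k+1} to the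
    second produces the two blocks of P (z_k - z_{k+1}).

    The delicate point is that the subdifferential is empty where the function
    is infinite: a minimizer has a finite value only if the function is proper.
    For [f] this is assumed; for [g^*] it must be proved, i.e. one needs an
    affine minorant of [g], equivalently one subgradient of [g] somewhere
    ([subdiff_nonempty]).  To find it, minimize
    [g + c |. - a|^2] on a box around a point [a] of the domain of [g]: a
    minimizer exists by compactness and lower semicontinuity, and for [c] large
    compared with the variation of [g] it lies in the interior of the box.  It
    is then a local minimizer, and since [g] is convex the local form of
    Fermat's rule ([subdiff_local_min]) already yields a global subgradient. *)

Local Open Scope classical_set_scope.
Local Open Scope ring_scope.

(** * The Euclidean inner product *)

Lemma dotDr (R : realType) p (u v w : 'cV[R]_p) :
  dot u (v + w) = dot u v + dot u w.
Proof. by rewrite dotC dotDl !(dotC u). Qed.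

Lemma dotZl (R : realType) p (t : R) (u v : 'cV[R]_p) :
  dot (t *: u) v = t * dot u v.
Proof. by rewrite /dot linearZ /= -scalemxAl mxE. Qed.

Lemma dotZr (R : realType) p (t : R) (u v : 'cV[R]_p) :
  dot u (t *: v) = t * dot u v.
Proof. by rewrite dotC dotZl dotC. Qed.

Lemma dot0l (R : realType) p (u : 'cV[R]_p) : dot 0 u = 0.
Proof. by rewrite /dot trmx0 mul0mx mxE. Qed.

Lemma dotE (R : realType) p (u v : 'cV[R]_p) :
  dot u v = \sum_i u i 0 * v i 0.
Proof. by rewrite /dot mxE; apply: eq_bigr => i _; rewrite mxE. Qed.

(** * Continuity, compactness and existence of minimizers *)

Lemma trmx_continuous (T : topologicalType) p q :
  continuous (trmx : 'M[T]_(p, q) -> 'M[T]_(q, p)).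
Proof.
move=> M S [P MP PS]; exists (fun i j => P j i) => [i j|N NP].
  by have := MP j i; rewrite mxE.
by apply: PS => i j; rewrite mxE; exact: NP.
Qed.

Lemma dot_continuous (R : realType) p (T : topologicalType)
    (u v : T -> 'cV[R]_p) :
  continuous u -> continuous v -> continuous (fun y => dot (u y) (v y)).
Proof.
move=> cu cv; under eq_fun do rewrite dotE.
apply: continuous_big => [|i _ y]; first exact: add_continuous.
apply: cvgM.
- exact: (continuous_comp (cu y) (@coord_continuous _ _ _ i 0 _)).
- exact: (continuous_comp (cv y) (@coord_continuous _ _ _ i 0 _)).
Qed.

(** A box of row vectors is a product of segments, hence compact by Tychonoff;
    transposition carries it to column vectors. *)
Lemma compact_box (R : realType) p (a b : 'cV[R]_p) :
  compact [set y : 'cV[R]_p | forall i, a i 0 <= y i 0 <= b i 0].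
Proof.
pose B (i : 'I_p) : set R := `[a i 0, b i 0]%classic.
have BC : compact [set v : 'rV[R]_p | forall i, B i (v ord0 i)].
  by apply: rV_compact => i; exact: segment_compact.
suff -> : [set y : 'cV[R]_p | forall i, a i 0 <= y i 0 <= b i 0] =
          trmx @` [set v : 'rV[R]_p | forall i, B i (v ord0 i)].
  apply: continuous_compact BC.
  exact/continuous_subspaceT/trmx_continuous.
apply/seteqP; split => [y aby|_ [v vB <-] i] /=.
  by exists y^T; rewrite ?trmxK // => i; rewrite /B /= mxE in_itv /= aby.
by have := vB i; rewrite /B /= in_itv /= mxE.
Qed.

(** The sets of points of [K] lying below a given value of [h] are nested, so
    they generate a filter, which clusters at some [p] in [K].  If [h y < h p]
    for some [y], lower semicontinuity would separate [p] from the sublevel set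
    of [y]. *)
Lemma lsc_attains_min (R : realType) (T : topologicalType) (K : set T)
    (h : T -> \bar R) : lower_semicontinuous h -> compact K -> K !=set0 ->
  exists2 p, K p & forall y, K y -> (h p <= h y)%E.
Proof.
move=> hlsc Kcpt [y0 Ky0].
pose F := filter_from K (fun y => [set z | K z /\ (h z <= h y)%E]).
have FF : ProperFilter F.
  apply: filter_from_proper; last by move=> y Ky; exists y.
  apply: filter_from_filter => [|y y' Ky Ky']; first by exists y0.
  have [yy'|y'y] := leP (h y) (h y').
    by exists y => // z [Kz zy]; split; split => //; exact: le_trans yy'.
  by exists y' => // z [Kz zy]; split; split => //; exact: le_trans (ltW y'y).
have FK : F K by exists y0 => // z [].
have [p [Kp pF]] := Kcpt F FF FK; exists p => // y Ky.
rewrite leNgt; apply/negP => yp.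
have [a ya ap] : exists2 a : R, (h y <= a%:E)%E & (a%:E < h p)%E.
  case: (h y) (h p) yp => [r| |] [s| |] //; rewrite ?lte_fin => rs.
  - by exists r.
  - by exists r; rewrite ?ltry.
  - by exists (s - 1); rewrite ?leNye // lte_fin ltrBlDr ltrDl.
  - by exists 0; rewrite ?leNye ?ltry.
have [V pV aV] := hlsc _ _ ap.
have [z [[Kz zy] Vz]] : [set z | K z /\ (h z <= h y)%E] `&` V !=set0.
  by apply: pF => //; exists y.
by have := lt_le_trans (aV _ Vz) (le_trans zy ya); rewrite ltxx.
Qed.

Lemma lscD_continuous (R : realType) (T : topologicalType) (h : T -> \bar R)
    (q : T -> R) : lower_semicontinuous h -> continuous q ->
  lower_semicontinuous (fun y => (h y + (q y)%:E)%E).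
Proof.
move=> hlsc qc x a axh.
(* Split the strict inequality between [h] and [q]: both [b < h x] and
   [a - b < q x] persist near [x]. *)
have [b bh ab] : exists2 b, (b%:E < h x)%E & a - b < q x.
  case: (h x) axh => [r| |] //; rewrite -?EFinD ?lte_fin => axh.
    by exists ((a - q x + r) / 2); rewrite ?lte_fin; lra.
  by exists (a - q x + 1); rewrite ?ltry //; lra.
have [V xV bV] := hlsc _ _ bh.
exists (V `&` [set y | a - b < q y]).
  by apply: filterI => //; exact: (cvgr_gt _ (qc x)).
move=> y [/bV bhy /= aby].
have -> : a = b + (a - b) by lra.
by rewrite EFinD lteD.
Qed.

(** * Fermat's rule *)

(** Compare [y0] with [y0 + t (y - y0)] for small [t > 0].  By convexity of [phi],
    dividing by [t] leaves the subgradient inequality at [y] up to the second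
    order term [t * c * |y - y0|^2], which vanishes as [t] tends to 0.  Only
    points near [y0] are compared, yet the inequality holds for every [y]. *)
Lemma subdiff_local_min (R : realType) p (phi : 'cV[R]_p -> \bar R)
    (w a y0 : 'cV[R]_p) (c : R) :
  (forall y, phi y != -oo%E) -> convex_fun phi -> phi y0 \is a fin_num ->
  (\forall y \near y0, (phi y0 + (dot w (y0 - a) + c * sqnorm2 (y0 - a))%:E
     <= phi y + (dot w (y - a) + c * sqnorm2 (y - a))%:E)%E) ->
  subdiff phi y0 (- (w + (2 * c) *: (y0 - a))).
Proof.
move=> phiNy phic phi0 minq; split=> // y.
have /= := phiNy y; case phiy : (phi y) => [r| |] //; last by rewrite leey.
move=> _; move: phi0 minq; case phi0 : (phi y0) => [s| |] // _ minq.
rewrite -EFinD lee_fin; set d := y - y0; set v := _ *: _.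
set K := c * sqnorm2 d.
have seg : (fun t : R => y0 + t *: d) @ 0^'+ --> y0.
  apply: cvg_at_right_filter; rewrite -[X in _ --> X]addr0 -(scale0r d).
  by apply: cvgD; [exact: cvg_cst|apply: cvgZr_tmp; exact: cvg_id].
have segmin := seg _ minq.
have lim : (fun t : R => r + t * K) @ 0^'+ --> r.
  apply: cvg_at_right_filter.
  rewrite -[r in _ --> r]addr0 -[in X in _ --> X](mul0r K).
  by apply: cvgD; [exact: cvg_cst|apply: cvgMr_tmp; exact: cvg_id].
apply: (cvgr_to_ge lim).
near=> t.
have t0 : 0 < t by near: t; exact: nbhs_right_gt.
have t1 : t < 1 by near: t; exact: nbhs_right_lt.
have /= : (s%:E + (dot w (y0 - a) + c * sqnorm2 (y0 - a))%:E
  <= phi (y0 + t *: d)%R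
     + (dot w (y0 + t *: d - a) + c * sqnorm2 (y0 + t *: d - a))%:E)%E.
  by near: t; exact: segmin.
have t01 : 0 <= t <= 1 by rewrite !ltW.
have := phic y y0 t t01.
have -> : t *: y + (1 - t) *: y0 = y0 + t *: d.
  by rewrite scalerBr scalerBl scale1r addrC addrAC addrA.
rewrite phiy phi0 -!EFinM -EFinD.
case: (phi _) (phiNy (y0 + t *: d)) => [b _| |] //.
rewrite -!EFinD !lee_fin => cvx.
rewrite /v; have -> : y0 + t *: d - a = (y0 - a) + t *: d by rewrite addrAC.
move: (y0 - a) => e; rewrite /K; clear -cvx t0 t1; clearbody d.
rewrite /sqnorm2 dotNl (dotDl w) dotZl !(dotDr, dotDl, dotZr, dotZl).
rewrite (dotC d e) /sqnorm2 => min.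
rewrite -(ler_pM2l t0); nra.
Unshelve. all: by end_near. Qed.

(** Properness supplies the finiteness of [phi] at the minimizer, without which
    [subdiff phi y0] would be empty. *)
Lemma subdiff_argmin (R : realType) p (phi : 'cV[R]_p -> \bar R)
    (w a y0 : 'cV[R]_p) (c : R) :
  proper_fun phi -> convex_fun phi ->
  argmin (fun y => (phi y + (dot w (y - a) + c * sqnorm2 (y - a))%:E)%E) y0 ->
  subdiff phi y0 (- (w + (2 * c) *: (y0 - a))).
Proof.
move=> [phiNy [y1 phi1]] phic y0min; apply: subdiff_local_min => //.
  move: (y0min y1) (phiNy y0) phi1 (phiNy y1).
  by case: (phi y0) => [r| |] //; case: (phi y1).
by near=> y; exact: y0min.
Unshelve. all: by end_near. Qed.

(** * Properness and convexity of the conjugate *)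

(** A minimizer [y0] of [phi + c |. - a|^2] over the box of half-width 1 around a
    point [a] of the domain satisfies [c |y0 - a|^2 <= phi a - phi y0], which is
    at most the drop of [phi] from [a] to its minimum on the box.  If [c] exceeds
    that drop then [y0] is interior to the box, so it is a local minimizer on
    the whole space. *)
Lemma subdiff_nonempty (R : realType) p (phi : 'cV[R]_p -> \bar R) :
  proper_fun phi -> lower_semicontinuous phi -> convex_fun phi ->
  exists y v, subdiff phi y v.
Proof.
move=> [phiNy [a phia]] phil phic.
pose B := [set y : 'cV[R]_p |
  forall i, (a - const_mx 1) i 0 <= y i 0 <= (a + const_mx 1) i 0].
have Bcpt : compact B by exact: compact_box.
have Ba : B a by move=> i; rewrite !mxE; lra.
have B0 : B !=set0 by exists a.
have [s phias] : exists s, phi a = s%:E.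
  by move: (phiNy a) phia; case: (phi a) => // s; exists s.
have [b Bb bmin] := lsc_attains_min phil Bcpt B0.
have [r phibr] : exists r, phi b = r%:E.
  move: (phiNy b) (bmin a Ba); rewrite phias.
  by case: (phi b) => // r; exists r.
have rs : r <= s by have := bmin a Ba; rewrite phibr phias lee_fin.
pose c := s - r + 1.
pose q y := c * sqnorm2 (y - a).
have qc : continuous q.
  have subc : continuous (fun y : 'cV[R]_p => y - a).
    by move=> y; exact: (cvgB cvg_id (cvg_cst _)).
  have sqc := dot_continuous subc subc.
  by move=> y; exact: (cvgMl_tmp (sqc y)).
have [y0 By0 y0min] := lsc_attains_min (lscD_continuous phil qc) Bcpt B0.
have [t phi0t] : exists t, phi y0 = t%:E.
  move: (phiNy y0) (y0min a Ba); rewrite phias.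
  by case: (phi y0) => // t; exists t.
have sq1 : sqnorm2 (y0 - a) < 1.
  have := y0min a Ba.
  rewrite phias phi0t /q subrr [sqnorm2 0]dot0l -!EFinD lee_fin.
  have := bmin y0 By0; rewrite phibr phi0t lee_fin /c; nra.
have int i : -1 < y0 i 0 - a i 0 < 1.
  have : (y0 i 0 - a i 0) ^+ 2 < 1.
    apply: le_lt_trans sq1; rewrite /sqnorm2 dotE (bigD1 i) //= !mxE expr2.
    by rewrite lerDl sumr_ge0 // => j _; rewrite -expr2 sqr_ge0.
  by rewrite expr2 => ?; apply/andP; split; nra.
exists y0, (- (0 + (2 * c) *: (y0 - a))).
apply: subdiff_local_min => //; first by rewrite phi0t.
pose U i := [set y : 'cV[R]_p | -1 < y i 0 - a i 0 < 1].
have : \forall y \near y0, forall i, U i y.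
  apply: (@filter_forall _ _ U (nbhs y0) _) => i; rewrite /U.
  have coordc : (fun y : 'cV[R]_p => y i 0 - a i 0) @ y0 --> y0 i 0 - a i 0.
    exact: (cvgB (@coord_continuous _ _ _ i 0 y0) (cvg_cst _)).
  have /andP[lo hi] := int i.
  near=> y; apply/andP; split; near: y.
    exact: (cvgr_gt _ coordc).
  exact: (cvgr_lt _ coordc).
apply: filterS => y yint; rewrite !dot0l !add0r; apply: y0min => i.
by have /andP[? ?] := yint i; rewrite !mxE; apply/andP; split; lra.
Unshelve. all: by end_near. Qed.

(** If [v] is a subgradient of [phi] at [y0], then [y0] attains the supremum
    defining the conjugate at [v], which is therefore finite. *)
Lemma proper_conjugate (R : realType) p (phi : 'cV[R]_p -> \bar R) :
  proper_fun phi -> lower_semicontinuous phi -> convex_fun phi ->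
  proper_fun (conjugate phi).
Proof.
move=> phip phil phic; split=> [l|]; first exact: conjugate_Ny.
have [y0 [v [phi0 vsub]]] := subdiff_nonempty phip phil phic; exists v.
rewrite -ltey; apply: (@le_lt_trans _ _ ((dot v y0)%:E - phi y0)%E); last first.
  by case: (phi y0) phi0 => // r _; rewrite ltry.
apply: ge_ereal_sup => _ [y _ <-].
have := vsub y; case: (phi y0) phi0 => // r _.
case: (phi y) => [s| |] //; last by rewrite leNye.
by rewrite -!EFinN -!EFinD !lee_fin dotBr; lra.
Qed.

(** The conjugate is a supremum of functions affine in [l]; properness excludes
    the value [-oo] of [phi], for which such a function would be [+oo]. *)
Lemma convex_conjugate (R : realType) p (phi : 'cV[R]_p -> \bar R) :
  proper_fun phi -> convex_fun (conjugate phi).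
Proof.
move=> [phiNy _] l l' t /andP[t0 t1]; apply: ge_ereal_sup => _ [y _ <-].
have sup k : ((dot k y)%:E - phi y <= conjugate phi k)%E.
  by apply: ereal_sup_ubound; exists y.
move: (phiNy y) (sup l) (sup l'); case: (phi y) => [r| |] // _ supl supl'.
  have -> : ((dot (t *: l + (1 - t) *: l') y)%:E - r%:E)%E =
      (t%:E * ((dot l y)%:E - r%:E) + (1 - t)%:E * ((dot l' y)%:E - r%:E))%E.
    rewrite -!EFinN -!EFinD dotDl !dotZl; congr _%:E; ring.
  by apply: leeD; apply: lee_wpmul2l => //; rewrite lee_fin // subr_ge0.
by rewrite leNye.
Qed.

(** * The PDHG inclusion *)

Theorem lemma2 (R : realType) (n m : nat)
    (f : 'cV[R]_n -> \bar R) (g : 'cV[R]_m -> \bar R)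
    (A : 'M[R]_(m, n)) (eta : R)
    (x : nat -> 'cV[R]_n) (lam : nat -> 'cV[R]_m) :
  proper_fun f -> lower_semicontinuous f -> convex_fun f ->
  proper_fun g -> lower_semicontinuous g -> convex_fun g ->
  0 < eta ->
  pdhg f g A eta x lam ->
  let z k : 'cV[R]_(n + m) := col_mx (x k) (lam k) in
  forall k : nat,
    saddle_op f g A (z k.+1) (pdhg_mx A eta *m (z k - z k.+1)).
Proof.
move=> fp fl fc gp gl gc _ step z k; have [xmin lmin] := step k.
have etaE : 2 * (2 * eta)^-1 = eta^-1 :> R.
  by rewrite invfM mulrA divff ?mul1r // pnatr_eq0.
rewrite saddle_opE //.
(* The witnesses are minus the gradients of the two quadratic terms. *)
exists (- (- (A^T *m lam k) + eta^-1 *: (x k.+1 - x k))).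
  rewrite -etaE; apply: subdiff_argmin => // y.
  by rewrite !dotNl; exact: xmin.
exists (- (A *m (2 *: x k.+1 - x k) + eta^-1 *: (lam k.+1 - lam k))).
  rewrite -etaE; apply: subdiff_argmin => //.
  - exact: proper_conjugate.
  - exact: convex_conjugate.
rewrite /z opp_col_mx add_col_mx mul_block_col !mul_scalar_mx.
congr col_mx; rewrite opprD -scalerN opprB.
  by rewrite opprK addrAC -mulmxBr addrC.
rewrite addrAC; congr (_ + _).
rewrite -mulmxN -mulmxDr; congr (_ *m _).
by apply/colP => i; rewrite !mxE; ring.
Qed.
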